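(* Let $k$ be a field of characteristic $0$, and let $f=(f_1,\ldots,f_n)\colon\mathbb{A}^n_k\to\mathbb{A}^n_k$ be a polynomial morphism. Assume $\mathrm{Jac}(f)\in k^\times$. If the Bézoutian $\mathrm{B\acute ez}(f)$ is constant (i.e. $\mathrm{B\acute ez}(f)\in k$), then $f$ is invertible.
   Context: Write $\mathbf{x}=(x_1,\ldots,x_n)$, $\mathbf{y}=(y_1,\ldots,y_n)$. A polynomial morphism $f\colon\mathbb{A}^n_k\to\mathbb{A}^n_k$ is given by polynomials $f_1,\ldots,f_n\in k[\mathbf{x}]$. $\mathrm{Jac}(f):=\det(\partial f_i/\partial x_j)$. ''Invertible'' means that $f$ has a two-sided inverse that is a polynomial morphism. The (multivariate) Bézoutian of $f$ is the determinant $\mathrm{B\acute ez}(f):=\det(\Delta_{ij})\in k[\mathbf{x},\mathbf{y}]$, where $$\Delta_{ij}=\frac{f_i(y_1,\ldots,y_{j-1},x_j,\ldots,x_n)-f_i(y_1,\ldots,y_j,x_{j+1},\ldots,x_n)}{x_j-y_j}.$$ *)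

(* Defs.v *)
From HB Require Import structures.
From mathcomp Require Import all_boot all_order all_algebra.
From mathcomp Require Import mpoly.

Set Implicit Arguments.
Unset Strict Implicit.
Unset Printing Implicit Defensive.

Import GRing.Theory.
Local Open Scope ring_scope.

(* A polynomial morphism A^n -> A^n is the n-tuple of its components. *)
Definition polymor (k : fieldType) (n : nat) := n.-tuple {mpoly k[n]}.

Section PolynomialMorphisms.

Variables (k : fieldType) (n : nat).
Implicit Types (f g : polymor k n) (i j l : 'I_n).

Definition pm_id : polymor k n := [tuple 'X_i | i < n].

(* The composite f o g: substitute the components of g in those of f. *)
Definition pm_comp f g : polymor k n := [tuple tnth f i \mPo g | i < n].

Definition pm_invertible f : Prop :=
  exists g, pm_comp f g = pm_id /\ pm_comp g f = pm_id.

Definition Jac f : {mpoly k[n]} :=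
  \det (\matrix_(i < n, j < n) (tnth f i)^`M(j)).

(* k[x, y] is {mpoly k[n + n]}, the x's being the first n variables. *)
Definition bez_x l : {mpoly k[n + n]} := 'X_(lshift n l).
Definition bez_y l : {mpoly k[n + n]} := 'X_(rshift n l).

(* The point whose first j coordinates are those of y and the others those
   of x. *)
Definition bez_point (j : nat) : n.-tuple {mpoly k[n + n]} :=
  [tuple if (l < j)%N then bez_y l else bez_x l | l < n].

(* The column index j counts from 0, so the numerator of Delta_ij is
   f_i(y_0, .., y_(j-1), x_j, ..) - f_i(y_0, .., y_j, x_(j+1), ..). *)
Definition bez_num f i j : {mpoly k[n + n]} :=
  (tnth f i \mPo bez_point j) - (tnth f i \mPo bez_point j.+1).

Lemma bez_num_dvd f i j :
  exists d, bez_num f i j == d * (bez_x j - bez_y j).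
Proof.
rewrite /bez_num; set u := bez_point j; set v := bez_point j.+1.
set w := bez_x j - bez_y j.
have Huv l : exists d, tnth u l - tnth v l = d * w.
  rewrite !tnth_mktuple ltnS [(l <= j)%N]leq_eqVlt.
  case: ltngtP => [lj|jl|lj] /=; try by exists 0; rewrite subrr mul0r.
  by exists 1; rewrite mul1r (val_inj lj).
have HM a b a' b' : (exists d, a - b = d * w) -> (exists d, a' - b' = d * w) ->
    exists d, a * a' - b * b' = d * w.
  move=> [d Hd] [d' Hd']; exists (d * a' + b * d').
  rewrite mulrDl -(mulrAC d) -Hd -mulrA -Hd' mulrBl mulrBr.
  by rewrite addrA subrK.
have HX m l : exists d, tnth u l ^+ m - tnth v l ^+ m = d * w.
  elim: m => [|m IH]; first by exists 0; rewrite !expr0 subrr mul0r.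
  by rewrite !exprS; apply: HM.
suff [d Hd]: exists d, (tnth f i \mPo u) - (tnth f i \mPo v) = d * w.
  by exists d; apply/eqP.
elim/mpolyind: (tnth f i) => [|c m p _ _ [d Hd]].
  by exists 0; rewrite !comp_mpoly0 subrr mul0r.
have [d' Hd'] : exists d, ('X_[m] \mPo u) - ('X_[m] \mPo v) = d * w.
  rewrite !comp_mpolyX; apply: (big_ind2 (fun a b => exists d, a - b = d * w)).
  - by exists 0; rewrite subrr mul0r.
  - by move=> a b a' b'; apply: HM.
  - by move=> l _; apply: HX.
exists (c *: d' + d); rewrite !comp_mpolyD !comp_mpolyZ.
by rewrite mulrDl -Hd -scalerAl -Hd' scalerBr opprD addrACA.
Qed.

(* Exact division in k[x, y], where the quotient is unique. *)
Definition Delta f i j : {mpoly k[n + n]} := xchoose (bez_num_dvd f i j).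

Lemma DeltaP f i j : Delta f i j * (bez_x j - bez_y j) = bez_num f i j.
Proof. by rewrite -(eqP (xchooseP (bez_num_dvd f i j))). Qed.

Definition Bez f : {mpoly k[n + n]} :=
  \det (\matrix_(i < n, j < n) Delta f i j).

Lemma bez_x_subr_y_neq0 j : bez_x j - bez_y j != 0.
Proof.
rewrite subr_eq0; apply/negP => /eqP E.
have := congr1 (mcoeff U_(lshift n j)) E; rewrite !mcoeffX eqxx.
case: eqP => [H|_ /eqP]; last by rewrite oner_eq0.
have := congr1 (fun m : 'X_{1.. n + n} => m (lshift n j)) H.
by rewrite !mnm1E eqxx eq_rlshift.
Qed.

Lemma Delta_unique f i j d :
  d * (bez_x j - bez_y j) = bez_num f i j -> d = Delta f i j.
Proof.
by rewrite -DeltaP; apply: mulIf; apply: bez_x_subr_y_neq0.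
Qed.

End PolynomialMorphisms.

(* Main.v *)
(* Let phi : k[u] -> k[x] be substitution of f; Jac f <> 0 and characteristic 0
   give derivations D_i of k[x] with D_i(phi g) = phi(d_i g), hence phi is
   injective.  On the diagonal Bez f specializes to Jac f, so a constant Bez f
   is nonzero, and Cramer's rule puts x_j - y_j in the ideal of the
   f_i(x) - f_i(y).  So k[f] -> k[x] is an epimorphism of rings, which forces
   x_j into the fraction field of k[f]: q(f) x_j = p(f) with q <> 0.  To clear
   the denominator, let P be a prime of k[x] dividing q(f), hence also p(f).
   The D_i show that the contraction of (P) to k[u] is a principal prime ideal,
   so p and q have a common factor, and descent on deg q gives x_j in k[f]. *)
Require Import Defs.
From mathcomp Require Import all_boot all_order all_algebra.
From mathcomp Require Import mpoly ring.
From Stdlib Require Import Classical.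

Set Implicit Arguments.
Unset Strict Implicit.
Unset Printing Implicit Defensive.

Import GRing.Theory.
Local Open Scope ring_scope.

(** * Factorial domains and Gauss's lemma *)

Section Divisibility.

Variable R : idomainType.
Implicit Types a b c p q u : R.

Definition divides p a := exists c, a = c * p.

Definition prime_elt p :=
  [/\ p != 0, p \isn't a GRing.unit &
      forall a b, divides p (a * b) -> divides p a \/ divides p b].

Inductive factored : nat -> R -> Prop :=
| factored_unit u : u \is a GRing.unit -> factored 0 u
| factored_mul m p a : prime_elt p -> factored m a -> factored m.+1 (p * a).

(** The factors are prime, not merely irreducible, so existence alone encodes unique factorization
    up to units. *)
Definition is_factorial := forall a, a != 0 -> exists m, factored m a.

Lemma divides0 p : divides p 0.
Proof. by exists 0; rewrite mul0r. Qed.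

Lemma dividesD p a b : divides p a -> divides p b -> divides p (a + b).
Proof. by move=> [c ->] [d ->]; exists (c + d); rewrite mulrDl. Qed.

Lemma divides_mull p c a : divides p a -> divides p (c * a).
Proof. by move=> [d ->]; exists (c * d); rewrite mulrA. Qed.

Lemma divides_mulr p c a : divides p a -> divides p (a * c).
Proof. by rewrite mulrC; apply: divides_mull. Qed.

Lemma dividesN p a : divides p a -> divides p (- a).
Proof. by rewrite -mulN1r; apply: divides_mull. Qed.

Lemma dividesB p a b : divides p a -> divides p b -> divides p (a - b).
Proof. by move=> pa pb; apply: dividesD => //; apply: dividesN. Qed.

Lemma prime_ndvd_unit p u : prime_elt p -> u \is a GRing.unit -> ~ divides p u.
Proof.
move=> [_ /negP np _] uu [c cp].
by move: uu; rewrite cp unitrM => /andP[].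
Qed.

Lemma factored_neq0 m a : factored m a -> a != 0.
Proof.
elim=> [u|{}m p {}a [p0 _ _] _ a0]; last by rewrite mulf_neq0.
by apply: contraTneq => ->; rewrite unitr0.
Qed.

Lemma factored_mul_unit m u a :
  u \is a GRing.unit -> factored m a -> factored m (u * a).
Proof.
move=> uu fa; elim: fa => [v vu|{}m p {}a pp _ IH].
  by apply: factored_unit; rewrite unitrM uu.
by rewrite mulrCA; apply: factored_mul.
Qed.

Lemma factored_prod m n a b : factored m a -> factored n b ->
  factored (m + n) (a * b).
Proof.
move=> fa fb; elim: fa => [u uu|{}m p {}a pp _ IH].
  exact: factored_mul_unit.
by rewrite -mulrA; apply: factored_mul.
Qed.

(** A prime dividing [a] is associated to one of the listed prime factors and cancels against it,
    which leaves one prime fewer. *)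
Lemma factored_divl m a p b : prime_elt p -> factored m a -> a = p * b ->
  exists2 m', m = m'.+1 & factored m' b.
Proof.
move=> pp fa; elim: fa b => [u uu|{}m q {}a pq fa IH] b E.
  by case: (prime_ndvd_unit pp uu); exists b; rewrite E mulrC.
have [p0 /negP nup dp] := pp; have [q0 /negP nuq dq] := pq.
have [[c qE]|[c aE]] : divides p q \/ divides p a.
  by apply: dp; exists b; rewrite E mulrC.
(* Here [q = c * p]: if [q] divides [c] then [p] is a unit, which is excluded; if [q] divides [p]
   then [c] is a unit. *)
- have [[d cE]|[d pE]] : divides q c \/ divides q p.
    by apply: dq; exists 1; rewrite mul1r.
  + case: nup; apply/unitrPr; exists d.
    by apply: (mulIf q0); rewrite mul1r {2}qE cE; ring.
  have cu : c \is a GRing.unit.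
    apply/unitrPr; exists d.
    by apply: (mulIf q0); rewrite mul1r {2}qE pE; ring.
  exists m => //; suff -> : b = c * a by apply: factored_mul_unit.
  by apply: (mulfI p0); rewrite -E qE; ring.
have [|m' -> fc] := IH c; first by rewrite aE mulrC.
exists m'.+1 => //; suff -> : b = q * c by apply: factored_mul.
by apply: (mulfI p0); rewrite -E aE; ring.
Qed.

Lemma exists_prime_divisor a : is_factorial ->
  a != 0 -> a \isn't a GRing.unit ->
  exists p c, [/\ prime_elt p, c != 0 & a = c * p].
Proof.
move=> fR /fR [m fa]; case: fa => [u -> //|{}m p c pp /factored_neq0 c0] _.
by exists p, c; split=> //; rewrite mulrC.
Qed.

End Divisibility.

(** Up to a unit, [h a] is the product of the images of the prime factors of [a], and [p] divides
    one of these images. *)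
Lemma prime_factor_morph (R S : idomainType) (h : {rmorphism R -> S})
    (p : S) (a : R) :
  is_factorial R -> prime_elt p -> a != 0 -> divides p (h a) ->
  exists q c, [/\ prime_elt q, c != 0, a = c * q & divides p (h q)].
Proof.
move=> fR pp /fR [m fa]; elim: fa => [u uu|{}m q {}a pq fa IH].
  by move/(prime_ndvd_unit pp (rmorph_unit h uu)).
have [_ _ pM] := pp; rewrite rmorphM => /pM [hq|/IH [r [c [pr c0 -> hr]]]].
  by exists q, a; split=> //; [apply: factored_neq0 fa | rewrite mulrC].
exists r, (q * c); split=> //; last by rewrite mulrA.
by rewrite mulf_neq0 //; case: pq.
Qed.

Section Isomorphism.

Variables (R S : idomainType).
Variables (h : {rmorphism R -> S}) (h' : {rmorphism S -> R}).
Hypotheses (hK : cancel h h') (h'K : cancel h' h).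

Lemma prime_elt_iso p : prime_elt p -> prime_elt (h p).
Proof.
move=> [p0 pu pM]; split.
- by apply: contraNneq p0 => hp0; rewrite -(hK p) hp0 rmorph0.
- by apply: contraNN pu => hu; rewrite -(hK p) rmorph_unit.
move=> a b [c E]; have [|[d dE]|[d dE]] := pM (h' a) (h' b).
- by exists (h' c); rewrite -rmorphM E rmorphM hK.
- by left; exists (h d); rewrite -rmorphM -dE h'K.
- by right; exists (h d); rewrite -rmorphM -dE h'K.
Qed.

Lemma factored_iso m a : factored m a -> factored m (h a).
Proof.
elim=> [u uu|{}m p {}a pp _ IH].
  by apply: factored_unit; apply: rmorph_unit.
by rewrite rmorphM; apply: factored_mul => //; apply: prime_elt_iso.
Qed.

Lemma factorial_iso : is_factorial R -> is_factorial S.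
Proof.
move=> fR a a0; have [|m fa] := fR (h' a); last first.
  by exists m; rewrite -(h'K a); apply: factored_iso.
by apply: contraNneq a0 => ha0; rewrite -(h'K a) ha0 rmorph0.
Qed.

End Isomorphism.

Section Gauss.

Variable R : idomainType.
Implicit Types (p r : R) (a b g : {poly R}).

Lemma divides_polyC p a : divides p%:P a <-> forall i, divides p a`_i.
Proof.
split=> [[c ->] i|]; first by exists c`_i; rewrite coefMC.
elim/poly_ind: a => [|a c IH] pa; first exact: divides0.
apply: dividesD; last first.
  have [d] := pa 0; rewrite coefD coefMX coefC /= add0r => ->.
  by exists d%:P; rewrite polyCM.
apply/divides_mulr/IH => i; have := pa i.+1.
by rewrite coefD coefMX coefC /= addr0.
Qed.

Lemma divides_polyC_MX p a : divides p%:P (a * 'X) -> divides p%:P a.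
Proof.
move/divides_polyC => pa; apply/divides_polyC => i.
by have := pa i.+1; rewrite coefMX.
Qed.

Lemma prime_elt_polyC p : prime_elt p -> prime_elt p%:P.
Proof.
move=> [p0 pu pM]; split; first by rewrite polyC_eq0.
  by rewrite poly_unitE size_polyC p0 coefC.
elim/poly_ind=> [|a c IHa] b; first by left; apply: divides0.
have [pc|npc] := classic (divides p c).
  have pcP : divides p%:P c%:P by case: pc => d ->; exists d%:P; rewrite polyCM.
  move=> pab; case: (IHa b) => [|pa|pb]; last by right.
    apply: divides_polyC_MX; rewrite mulrAC.
    have -> : a * 'X * b = (a * 'X + c%:P) * b - c%:P * b.
      by rewrite mulrDl addrK.
    by apply: dividesB => //; apply: divides_mulr.
  by left; apply: dividesD => //; apply: divides_mulr.
elim/poly_ind: b => [|b d IHb] pab; first by right; apply: divides0.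
have pd : divides p d.
  have /divides_polyC/(_ 0) := pab.
  rewrite coef0M !coefD !coefMX !coefC /= !add0r => /pM [] //.
have pdP : divides p%:P d%:P by case: pd => e ->; exists e%:P; rewrite polyCM.
case: IHb => [|pa|pb]; [|by left|]; last first.
  by right; apply: dividesD => //; apply: divides_mulr.
apply: divides_polyC_MX; rewrite -mulrA.
have -> : (a * 'X + c%:P) * (b * 'X) =
  (a * 'X + c%:P) * (b * 'X + d%:P) - (a * 'X + c%:P) * d%:P.
  by rewrite -mulrBr addrK.
by apply: dividesB => //; apply: divides_mull.
Qed.

Lemma factored_polyC m r : factored m r -> factored m r%:P.
Proof.
elim=> [u uu|{}m p {}r pp _ IH].
  by apply: factored_unit; rewrite rmorph_unit.
by rewrite polyCM; apply: factored_mul => //; apply: prime_elt_polyC.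
Qed.

(** The primes of [r] are cancelled one at a time from [b] or [c]. A factorization over the fraction
    field thus descends to [R], with factors of the same degrees. *)
Lemma polyC_factor_cancel m r a b c : factored m r -> r%:P * a = b * c ->
  exists b' c', [/\ a = b' * c', exists2 s, s != 0 & b = s%:P * b' &
                    exists2 s, s != 0 & c = s%:P * c'].
Proof.
move=> fr; elim: fr a b c => [u uu|{}m p {}r pp fr IH] a b c E.
  exists (u^-1%:P * b), c; split.
  - by rewrite -mulrA -E mulrA -polyCM mulVr // mul1r.
  - exists u; first by apply: contraTneq uu => ->; rewrite unitr0.
    by rewrite mulrA -polyCM divrr // mul1r.
  - by exists 1; rewrite ?oner_neq0 // mul1r.
have p0 : p != 0 by case: pp.
have pP0 : p%:P != 0 by rewrite polyC_eq0.
have [_ _ pM] := prime_elt_polyC pp.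
have [[b1 bE]|[c1 cE]] : divides p%:P b \/ divides p%:P c.
- by apply: pM; exists (r%:P * a); rewrite -E polyCM -mulrA mulrC.
- have [|b' [c' [-> [s s0 sE] cE]]] := IH a b1 c.
    apply: (mulfI pP0).
    by rewrite mulrA -polyCM E bE mulrA [p%:P * _]mulrC.
  exists b', c'; split=> //; exists (s * p); first by rewrite mulf_neq0.
  by rewrite bE sE polyCM mulrAC.
have [|b' [c' [-> bE [s s0 sE]]]] := IH a b c1.
  by apply: (mulfI pP0); rewrite mulrA -polyCM E cE mulrA mulrC.
exists b', c'; split=> //; exists (s * p); first by rewrite mulf_neq0.
by rewrite cE sE polyCM mulrAC.
Qed.

Definition primitive_poly g := forall p, prime_elt p -> ~ divides p%:P g.

(** No prime of [r] divides [g], so each of them divides [b] and cancels. *)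
Lemma primitive_cancel m r a b g : primitive_poly g -> factored m r ->
  r%:P * a = b * g -> divides g a.
Proof.
move=> pg fr; elim: fr a b => [u uu|{}m p {}r pp fr IH] a b E.
  exists (u^-1%:P * b).
  by rewrite -mulrA -E mulrA -polyCM mulVr // mul1r.
have pP0 : p%:P != 0 by rewrite polyC_eq0; case: pp.
have [_ _ pM] := prime_elt_polyC pp.
have [[b1 bE]|/(pg _ pp)//] : divides p%:P b \/ divides p%:P g.
  by apply: pM; exists (r%:P * a); rewrite -E polyCM -mulrA mulrC.
apply: (IH a b1); apply: (mulfI pP0).
by rewrite mulrA -polyCM E bE mulrA [p%:P * _]mulrC.
Qed.

(** Each prime constant taken out of [g] also leaves the leading coefficient, whose number of primes
    bounds the process. *)
Lemma primitive_part m g : factored m (lead_coef g) ->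
  exists n r g', [/\ factored n r, primitive_poly g' & g = r%:P * g'].
Proof.
elim: m g => [|m IH] g fg.
  exists 0, 1, g; split; [exact/factored_unit/unitr1| |by rewrite mul1r].
  move=> p pp [c E]; have [] // := factored_divl pp fg (b := lead_coef c).
  by rewrite E lead_coefM lead_coefC mulrC.
have [pg|] := classic (primitive_poly g).
  exists 0, 1, g; split=> //; [exact/factored_unit/unitr1|by rewrite mul1r].
move=> npg; have [p [pp [c E]]] : exists p, prime_elt p /\ divides p%:P g.
  apply: NNPP => H; apply: npg => p pp pg; apply: H; by exists p.
have [|m' [mE] fc] := factored_divl pp fg (b := lead_coef c).
  by rewrite E lead_coefM lead_coefC mulrC.
rewrite -mE in fc; have [n [r [g' [fr pg' cE]]]] := IH c fc.
exists n.+1, (p * r), g'; split=> //; first exact: factored_mul.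
by rewrite E cE polyCM mulrC mulrA.
Qed.

(* The last hypothesis is irreducibility over the fraction field of [R]. *)
Lemma primitive_irreducible_prime g : is_factorial R -> (1 < size g)%N ->
  primitive_poly g ->
  (forall r a b, r != 0 -> r%:P * g = a * b ->
    (size a == 1%N) || (size b == 1%N)) ->
  prime_elt g.
Proof.
move=> fR sg pg irr; have g0 : g != 0 by rewrite -size_poly_gt0 ltnW.
split=> //; first by rewrite poly_unitE; case: (size g) sg => [|[]].
move=> a b [c abE].
(* The relation [%|] allows a nonzero constant multiple of the dividend; primitivity of [g] removes
   that constant. *)
have dvdE x : g %| x -> divides g x.
  case/Pdiv.WeakIdomain.dvdpP => -[r q] /= r0 E.
  have [m fr] := fR r r0; apply: (primitive_cancel (b := q) pg fr).
  by rewrite mul_polyC.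
have gab : g %| a * b by rewrite abE; apply: dvdp_mull.
have [/dvdE|nga] := boolP (g %| a); first by left.
right; apply: dvdE; rewrite -(Gauss_dvdpr _ (q := a)) //.
have /Pdiv.WeakIdomain.dvdpP [[r q] /= r0 E] := dvdp_gcdl g a.
rewrite coprimep_def.
(* Either the gcd is constant and [g] is coprime to [a], or the quotient [q] is constant and [g]
   divides [a]. *)
have /orP[sq|//] := irr r q (gcdp g a) r0 (etrans (mul_polyC _ _) E).
case/negP: nga; apply: dvdp_trans (dvdp_gcdr g a).
have [d d0 qE] := size_poly1P _ sq.
apply/Pdiv.WeakIdomain.dvdpP; exists (d, r%:P) => //=.
by rewrite mul_polyC E qE mul_polyC.
Qed.

(** Let d be the gcd, with [a] w = [q] d. If [w] divides [q], then d divides the constant [a]. If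
    [w] divides d, it divides a constant multiple of [g], hence the constant or [g], which is
    impossible. So d is constant, and [r] comes from a Bezout relation. *)
Lemma prime_poly_bezout (w g : {poly R}) :
  prime_elt w -> (1 < size w)%N -> ~ divides w g ->
  exists u v, exists2 r, r != 0 & u * w + v * g = r%:P.
Proof.
move=> [w0 _ wM] sw wg; suff cop : coprimep w g.
  have /Bezout_coprimepP [[u v] /= /eqp_size] := cop.
  rewrite size_poly1 => /eqP/size_poly1P [r r0 E].
  by exists u, v, r.
have d0 : gcdp w g != 0 by rewrite gcdp_eq0 (negbTE w0).
have /Pdiv.WeakIdomain.dvdpP [[a q] /= a0 E] := dvdp_gcdl w g.
have /Pdiv.WeakIdomain.dvdpP [[b q'] /= b0 E'] := dvdp_gcdr w g.
have ndvd r : r != 0 -> ~ divides w r%:P.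
  move=> r0 [c rE]; have := dvdp_leq (p := w) (q := r%:P).
  by rewrite polyC_eq0 size_polyC r0 leqNgt sw rE dvdp_mull // => /(_ isT isT).
rewrite coprimep_def; have [|[r rE]|[r rE]] := wM q (gcdp w g).
- by exists a%:P; rewrite mul_polyC E.
- have aE : a%:P = r * gcdp w g.
    by apply: (mulIf w0); rewrite mul_polyC E rE mulrAC.
  rewrite eqn_leq size_poly_gt0 d0 andbT.
  have := dvdp_leq (p := gcdp w g) (q := a%:P); rewrite polyC_eq0 size_polyC a0.
  by apply=> //; rewrite aE dvdp_mull.
have [|/(ndvd _ b0) []|//] := wM b%:P g.
by exists (q' * r); rewrite mul_polyC E' {1}rE mulrA.
Qed.

(** Strong induction on the size. If [g] splits over the fraction field into nonconstant factors, it
    splits over [R] into smaller ones; otherwise its primitive part is prime and its content factors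
    in [R]. *)
Lemma is_factorial_poly : is_factorial R -> is_factorial {poly R}.
Proof.
move=> fR g; have [n] := ubnP (size g); elim: n g => // n IH g sgn g0.
have [sg1|sg1] := leqP (size g) 1.
  have [c c0 ->] : exists2 c, c != 0 & g = c%:P.
    by apply/size_poly1P; rewrite eqn_leq sg1 size_poly_gt0.
  by have [m fc] := fR c c0; exists m; apply: factored_polyC.
have [[r [a [b [r0 rE /andP[sa sb]]]]]|irr] := classic (exists r a b,
  [/\ r != 0, r%:P * g = a * b & (size a != 1%N) && (size b != 1%N)]).
  have [m fr] := fR r r0.
  have rg0 : a * b != 0 by rewrite -rE mulf_neq0 // polyC_eq0.
  have [a' [b' [gE [s s0 aE] [t t0 bE]]]] := polyC_factor_cancel fr rE.
  have [a0 b0] : a' != 0 /\ b' != 0.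
    by apply/andP; rewrite -negb_or -mulf_eq0 -gE.
  have sa' : size a = size a' by rewrite aE size_Cmul.
  have sb' : size b = size b' by rewrite bE size_Cmul.
  have sz : size g = (size a' + size b').-1 by rewrite gE size_mul.
  have pa : (1 < size a')%N.
    by rewrite ltn_neqAle eq_sym -sa' sa sa' size_poly_gt0.
  have pb : (1 < size b')%N.
    by rewrite ltn_neqAle eq_sym -sb' sb sb' size_poly_gt0.
  have [|//|k fa] := IH a'.
    move: sgn pb; rewrite sz ltnS; case: (size b') => [|[|q]] // H _.
    by apply: leq_trans H; rewrite !addnS ltnS leq_addr.
  have [|//|l fb] := IH b'.
    move: sgn pa; rewrite sz ltnS; case: (size a') => [|[|q]] // H _.
    by apply: leq_trans H; rewrite !addSn ltnS leq_addl.
  by exists (k + l)%N; rewrite gE; apply: factored_prod.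
have [m fl] := fR (lead_coef g) (etrans (congr1 negb (lead_coef_eq0 g)) g0).
have [k [r [g' [fr pg gE]]]] := primitive_part fl.
have r0 := factored_neq0 fr.
have sg : size g = size g' by rewrite gE size_Cmul.
exists (k + 1)%N; rewrite gE; apply: factored_prod; first exact: factored_polyC.
rewrite -[g']mulr1; apply: factored_mul; last exact/factored_unit/unitr1.
apply: primitive_irreducible_prime => //; first by rewrite -sg.
move=> s a b s0 E; apply/negPn/negP; rewrite negb_or => sab; apply: irr.
exists s, (r%:P * a), b; split=> //; first by rewrite gE mulrCA E mulrA.
by rewrite size_Cmul.
Qed.

End Gauss.

(** * Polynomials in several variables *)

Section MPolyInduction.

Variables (R : comNzRingType) (n : nat).
Implicit Types p q : {mpoly R[n]}.

Lemma mpoly_ring_ind (P : {mpoly R[n]} -> Prop) :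
  (forall c, P c%:MP) -> (forall i, P 'X_i) ->
  (forall p q, P p -> P q -> P (p + q)) ->
  (forall p q, P p -> P q -> P (p * q)) -> forall p, P p.
Proof.
move=> PC PX PD PM; elim/mpolyind=> [|c m p _ _ Pp]; first by rewrite -mpolyC0.
apply: (PD) => //; rewrite -mul_mpolyC; apply: (PM) => //.
rewrite mpolyXE_id; apply: big_ind => [||i _]; [by rewrite -mpolyC1|exact: PM|].
by elim: (m i) => [|d Pd]; rewrite ?expr0 -?mpolyC1 // exprS; apply: PM.
Qed.

Lemma mpoly_rmorph_eq (S : pzRingType) (g h : {rmorphism {mpoly R[n]} -> S}) :
  (forall c, g c%:MP = h c%:MP) -> (forall i, g 'X_i = h 'X_i) -> g =1 h.
Proof.
move=> ghC ghX; apply: mpoly_ring_ind => // p q E F.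
  by rewrite !rmorphD E F.
by rewrite !rmorphM E F.
Qed.

Lemma mderivXU i j : ('X_i : {mpoly R[n]})^`M(j) = (i == j)%:R.
Proof.
rewrite mderivX mnm1E; case: eqP => [->|_]; last by rewrite scale0r.
by rewrite -{1}[U_(j)%MM]add0m addmK scale1r mpolyX0.
Qed.

(** The chain rule. *)
Lemma mderiv_comp (m : nat) (g : n.-tuple {mpoly R[m]}) p (j : 'I_m) :
  (p \mPo g)^`M(j) = \sum_i (p^`M(i) \mPo g) * (tnth g i)^`M(j).
Proof.
elim/mpoly_ring_ind: p => [c|l|p q Ep Eq|p q Ep Eq].
- rewrite comp_mpolyC mderivC big1 // => i _.
  by rewrite mderivC comp_mpoly0 mul0r.
- rewrite comp_mpolyXU -tnth_nth (bigD1 l) //= mderivXU eqxx comp_mpoly1 mul1r.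
  rewrite big1 ?addr0 // => i /negbTE; rewrite eq_sym mderivXU => ->.
  by rewrite comp_mpoly0 mul0r.
- rewrite comp_mpolyD mderivD Ep Eq -big_split /=; apply: eq_bigr => i _.
  by rewrite mderivD comp_mpolyD mulrDl.
- rewrite rmorphM /= mderivM Ep Eq mulr_suml mulr_sumr -big_split /=.
  by apply: eq_bigr => i _; rewrite mderivM comp_mpolyD !rmorphM /=; ring.
Qed.

Lemma comp_mpolyA (m r : nat) (g : n.-tuple {mpoly R[m]})
    (h : m.-tuple {mpoly R[r]}) p :
  (p \mPo g) \mPo h = p \mPo [tuple tnth g i \mPo h | i < n].
Proof.
apply: (mpoly_rmorph_eq (g := comp_mpoly h \o comp_mpoly g)) => [c|i] /=.
  by rewrite !comp_mpolyC.
by rewrite !comp_mpolyXU -!tnth_nth tnth_mktuple.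
Qed.

End MPolyInduction.

Section Characteristic0.

Variables (k : fieldType) (n : nat).
Implicit Types p : {mpoly k[n]}.

Lemma msize_mderiv_lt p i : p != 0 -> (msize p^`M(i) < msize p)%N.
Proof.
move=> p0; have [->|d0] := eqVneq (p^`M(i)) 0.
  by rewrite msize0 lt0n msize_poly_eq0.
rewrite -(mlead_deg d0); have := mlead_supp d0; set m := mlead _.
rewrite mcoeff_msupp mcoeff_deriv => m0.
have : (m + U_(i))%MM \in msupp p.
  by rewrite mcoeff_msupp; apply: contraNneq m0 => ->; rewrite mul0rn.
by move/msize_mdeg_lt; rewrite mdegD mdeg1 addn1.
Qed.

(** For a monomial m with m_i > 0, its coefficient in [p] times m_i is a coefficient of the i-th
    partial derivative; characteristic 0 cancels m_i. *)
Lemma mderiv_eq0_const p : [pchar k] =i pred0 ->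
  (forall i, p^`M(i) = 0) -> p = (p@_0)%:MP.
Proof.
move=> k0 dp; apply/mpolyP => m; rewrite mcoeffC.
have [->|m0] := eqVneq 0%MM m; first by rewrite mulr1.
rewrite mulr0; have [i mi] : exists i, m i != 0%N.
  apply/existsP; apply: contraNT m0; rewrite negb_exists => /forallP H.
  by apply/eqP/mnmP => i; rewrite mnm0E; have := H i; rewrite negbK => /eqP.
have mE : m = (m - U_(i) + U_(i))%MM.
  rewrite submK //; apply/mnm_lepP => j; rewrite mnm1E.
  by case: eqP => // <-; rewrite lt0n.
have := congr1 (mcoeff (m - U_(i))%MM) (dp i).
rewrite mcoeff0 mcoeff_deriv -mE -mulr_natr => /eqP; rewrite mulf_eq0.
by rewrite ((pcharf0P _).1 k0) /= orbF => /eqP.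
Qed.

End Characteristic0.

(** * The isomorphism of k[x_0, .., x_n] with the polynomials in x_l over the other variables *)

Section SplitVariable.

Variables (k : fieldType) (n : nat) (l : 'I_n.+1).

Definition split_var_point (i : 'I_n.+1) : {poly {mpoly k[n]}} :=
  if unlift l i is Some j then ('X_j)%:P else 'X.

Definition split_var : {rmorphism {mpoly k[n.+1]} -> {poly {mpoly k[n]}}} :=
  mmap (polyC \o @mpolyC n k) split_var_point.

Definition insert_var : {rmorphism {mpoly k[n]} -> {mpoly k[n.+1]}} :=
  comp_mpoly [tuple 'X_(lift l j) | j < n].

Definition merge_var : {rmorphism {poly {mpoly k[n]}} -> {mpoly k[n.+1]}} :=
  horner_eval 'X_l \o map_poly insert_var.

Lemma split_varC c : split_var c%:MP = c%:MP%:P.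
Proof. exact: mmapC. Qed.

Lemma split_varX i : split_var 'X_i = split_var_point i.
Proof. by rewrite /split_var /= mmapX mmap1U. Qed.

Lemma insert_varC c : insert_var c%:MP = c%:MP.
Proof. exact: comp_mpolyC. Qed.

Lemma insert_varX j : insert_var 'X_j = 'X_(lift l j).
Proof. by rewrite /insert_var /= comp_mpolyXU -tnth_nth tnth_mktuple. Qed.

Lemma merge_varC p : merge_var p%:P = insert_var p.
Proof. by rewrite /merge_var /= map_polyC /= horner_evalE hornerC. Qed.

Lemma merge_varX : merge_var 'X = 'X_l.
Proof. by rewrite /merge_var /= map_polyX /= horner_evalE hornerX. Qed.

Lemma split_varK : cancel split_var merge_var.
Proof.
apply: (mpoly_rmorph_eq (g := merge_var \o split_var) (h := idfun)) => [c|i].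
  change (merge_var (split_var c%:MP) = c%:MP).
  by rewrite split_varC merge_varC insert_varC.
change (merge_var (split_var 'X_i) = 'X_i).
rewrite split_varX /split_var_point.
by case: unliftP => [j|] ->; rewrite ?merge_varC ?insert_varX ?merge_varX.
Qed.

Lemma split_insert p : split_var (insert_var p) = p%:P.
Proof.
move: p; apply: (mpoly_rmorph_eq (g := split_var \o insert_var) (h := polyC)).
  move=> c; change (split_var (insert_var c%:MP) = c%:MP%:P).
  by rewrite insert_varC split_varC.
move=> i; change (split_var (insert_var 'X_i) = ('X_i)%:P).
by rewrite insert_varX split_varX /split_var_point liftK.
Qed.

Lemma merge_varK : cancel merge_var split_var.
Proof.
elim/poly_ind=> [|p c IH]; first by rewrite !rmorph0.
rewrite !rmorphD !rmorphM IH merge_varC split_insert merge_varX split_varX.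
by rewrite /split_var_point unlift_none.
Qed.

Lemma mderiv_insert_var p : (insert_var p)^`M(l) = 0.
Proof.
rewrite /insert_var /= mderiv_comp big1 // => j _.
by rewrite tnth_mktuple mderivXU eq_sym (negbTE (neq_lift _ _)) mulr0.
Qed.

Lemma mderiv_insert_var_lift p j :
  (insert_var p)^`M(lift l j) = insert_var p^`M(j).
Proof.
rewrite /insert_var /= mderiv_comp (bigD1 j) //= big1 => [|i ij].
  by rewrite tnth_mktuple mderivXU eqxx mulr1 addr0.
by rewrite tnth_mktuple mderivXU (inj_eq (lift_inj (h := l))) (negbTE ij) mulr0.
Qed.

End SplitVariable.

(** Induction on the number of variables, one of them being split off at each step; without
    variables every nonzero polynomial is a unit. *)
Lemma is_factorial_mpoly (k : fieldType) (n : nat) : is_factorial {mpoly k[n]}.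
Proof.
elim: n => [|n IH].
  move=> p p0; exists 0%N; apply: factored_unit.
  have pE : p = (p@_0)%:MP.
    apply/mpolyP => m; rewrite mcoeffC (_ : m = 0%MM) ?eqxx ?mulr1 //.
    by apply/mnmP => -[].
  rewrite pE rmorph_unit // unitfE.
  by apply: contraNneq p0 => c0; rewrite pE c0.
apply: (factorial_iso (@merge_varK k n ord0) (@split_varK k n ord0)).
exact: is_factorial_poly.
Qed.

(** * Descent of denominators *)

Lemma minimal_element (T : Type) (P : T -> Prop) (mu : T -> nat) :
  (exists x, P x) -> exists2 x, P x & forall y, P y -> (mu x <= mu y)%N.
Proof.
case=> x; have [m] := ubnP (mu x); elim: m x => // m IH x mx Px.
have [[y Py yx]|nx] := classic (exists2 y, P y & (mu y < mu x)%N).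
  by apply: (IH y) => //; apply: leq_trans yx _.
by exists x => // y Py; rewrite leqNgt; apply/negP => yx; apply: nx; exists y.
Qed.

(** As its derivative is nonzero, [w] has positive degree in x_l, so a Bezout relation in that
    variable applies; [r] plays the role of a resultant. *)
Lemma elimination (k : fieldType) (n : nat) (l : 'I_n.+1)
    (w g : {mpoly k[n.+1]}) :
  prime_elt w -> w^`M(l) != 0 -> ~ divides w g ->
  exists2 r, r != 0 & exists u v, insert_var k l r = u * w + v * g.
Proof.
move=> pw dw wg; pose h := @split_var k n l.
have hK : cancel h (merge_var k l) by apply: split_varK.
have Kh : cancel (merge_var k l) h by apply: merge_varK.
have phw : prime_elt (h w) by apply: prime_elt_iso Kh _ pw.
have hwg : ~ divides (h w) (h g).
  move=> [c E]; apply: wg; exists (merge_var k l c).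
  by rewrite -[w]hK -rmorphM -E hK.
have shw : (1 < size (h w))%N.
  rewrite ltnNge; apply: contraNN dw => /size1_polyC E.
  by rewrite -[w]hK E merge_varC mderiv_insert_var.
have [u [v [r r0 E]]] := prime_poly_bezout phw shw hwg.
exists r => //; exists (merge_var k l u), (merge_var k l v).
by rewrite -[w]hK -[g]hK -!rmorphM -rmorphD E merge_varC.
Qed.

(** * Derivations attached to a morphism with constant nonzero Jacobian *)

Section Derivations.

Variables (k : fieldType) (n : nat) (f : polymor k n) (c : k).
Hypotheses (k0 : [pchar k] =i pred0) (c0 : c != 0) (fc : Jac f = c%:MP).

Let J : 'M_n := \matrix_(i < n, j < n) (tnth f i)^`M(j).

(* The derivation of k[x] extending d/du_i on k[u] along u_i |-> f_i. *)
Definition dual_deriv (i : 'I_n) (h : {mpoly k[n]}) :=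
  \sum_j h^`M(j) * invmx J j i.

Lemma dual_derivM i g h :
  dual_deriv i (g * h) = dual_deriv i g * h + g * dual_deriv i h.
Proof.
rewrite /dual_deriv mulr_suml mulr_sumr -big_split /=; apply: eq_bigr => j _.
by rewrite mderivM; ring.
Qed.

Lemma dual_deriv0 i : dual_deriv i 0 = 0.
Proof. by apply: big1 => j _; rewrite mderiv0 mul0r. Qed.

(** By the chain rule the gradient of p(f) is the row of the (d_i p)(f) times [J], and [J] is
    invertible because its determinant is a nonzero constant. *)
Lemma dual_deriv_comp i p : dual_deriv i (p \mPo f) = p^`M(i) \mPo f.
Proof.
have Ju : J \in unitmx.
  by rewrite unitmxE -/(Jac f) fc rmorph_unit // unitfE.
pose v := \row_i (p^`M(i) \mPo f).
have -> : p^`M(i) \mPo f = (v *m J *m invmx J) 0 i by rewrite mulmxK // mxE.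
rewrite mxE; apply: eq_bigr => j _; congr (_ * _).
by rewrite mderiv_comp mxE; apply: eq_bigr => l _; rewrite !mxE.
Qed.

(** Induction on the degree: the derivations carry p(f) = 0 to (d_i p)(f) = 0, so all d_i p vanish
    and [p] is a constant, unchanged by substitution. *)
Lemma comp_mpoly_inj0 p : p \mPo f = 0 -> p = 0.
Proof.
have [m] := ubnP (msize p); elim: m p => // m IH p pm pf.
apply/eqP; apply: contraT => p0.
have pE : p = (p@_0)%:MP.
  apply: mderiv_eq0_const => // i; apply: IH; last first.
    by rewrite -dual_deriv_comp pf dual_deriv0.
  exact: leq_trans (msize_mderiv_lt i p0) pm.
by move: pf; rewrite pE comp_mpolyC => /eqP; rewrite -pE (negbTE p0).
Qed.

End Derivations.

Section Descent.

Variables (k : fieldType) (n : nat) (f : polymor k n.+1) (c : k).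
Hypotheses (k0 : [pchar k] =i pred0) (c0 : c != 0) (fc : Jac f = c%:MP).

Let D := dual_deriv f.
Let DE := dual_deriv_comp c0 fc.

(* Take [q] of minimal degree in the contraction of (p) to k[u].  An element
   that [q] does not divide yields, by elimination, a nonzero [r] in the
   contraction that is free of a variable u_l with d_l q <> 0.  Writing
   r(f) = g p, d_l r = 0 makes p divide g, so all the partial derivatives of
   [r] lie in the contraction: [r] of minimal degree is constant, absurd. *)
Lemma contraction_principal (p a : {mpoly k[n.+1]}) :
  prime_elt p -> a != 0 -> divides p (a \mPo f) ->
  exists2 q, prime_elt q & forall b, divides p (b \mPo f) -> divides q b.
Proof.
move=> pp a0 pa; have [p0 pu pM] := pp.
(* [w] has minimal degree in the contraction; a prime factor [q] of [w] that lies there has minimal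
   degree as well. *)
have [w [w0 pw] wmin] := @minimal_element _
  (fun w => w != 0 /\ divides p (w \mPo f)) (fun w => msize w)
  (ex_intro _ a (conj a0 pa)).
have [q [d [pq d0 wE pf]]] := @prime_factor_morph _ _ (comp_mpoly f) p w
  (@is_factorial_mpoly k n.+1) pp w0 pw.
have {pf} pf : divides p (q \mPo f) by [].
have q0 : q != 0 by case: pq.
have qmin b : b != 0 -> divides p (b \mPo f) -> (msize q <= msize b)%N.
  move=> b0 pb; apply: leq_trans (wmin b (conj b0 pb)).
  by rewrite wE msizeM // (mpolySpred _ d0) addSn /= leq_addl.
have [l dl0] : exists l, q^`M(l) != 0.
  apply: NNPP => H; have [_ /negP nqu _] := pq; apply: nqu.
  have qE : q = (q@_0)%:MP.
    apply: mderiv_eq0_const => // i; apply/eqP/negPn/negP => di; apply: H.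
    by exists i.
  by rewrite qE rmorph_unit // unitfE; apply: contraNneq q0 => e; rewrite qE e.
have npl : ~ divides p (q^`M(l) \mPo f).
  move=> pl; have := qmin _ dl0 pl; rewrite leqNgt.
  by rewrite msize_mderiv_lt.
exists q => // b pb; apply: NNPP => nqb.
have [r0 r0_neq0 [u [v r0E]]] := elimination pq dl0 nqb.
pose ins := insert_var k l.
have pr0 : divides p (ins r0 \mPo f).
  rewrite /ins r0E comp_mpolyD !rmorphM /=.
  by apply: dividesD; apply: divides_mull.
have [r [rn0 pr] rmin] := @minimal_element _
  (fun r => r != 0 /\ divides p (ins r \mPo f)) (fun r => msize r)
  (ex_intro _ r0 (conj r0_neq0 pr0)).
have [h qE] := pf; have [g rE] := pr.
have pg : divides p g.
  have gl : divides p (g * D l p).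
    exists (- D l g); apply/eqP; rewrite -subr_eq0 mulNr opprK addrC.
    by rewrite -dual_derivM -rE DE mderiv_insert_var comp_mpoly0.
  have [//|[e lE]] := pM _ _ gl; case: npl.
  exists (D l h + h * e).
  by rewrite -DE qE dual_derivM -/D lE mulrDl mulrA.
have rC : r = (r@_0)%:MP.
  apply: mderiv_eq0_const => // i; apply/eqP/negPn/negP => dr0.
  have pdr : divides p (ins r^`M(i) \mPo f).
    rewrite /ins -mderiv_insert_var_lift -DE rE dual_derivM.
    by apply: dividesD; [exists (D (lift l i) g)|apply: divides_mulr].
  by have := rmin _ (conj dr0 pdr); rewrite leqNgt (msize_mderiv_lt i rn0).
apply: (prime_ndvd_unit pp) pr.
rewrite rC /ins insert_varC comp_mpolyC rmorph_unit // unitfE.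
by apply: contraNneq rn0 => e; rewrite rC e.
Qed.

(** A prime [p] of a(f) also divides b(f), so the [q] attached to [p] divides both [a] and [b], and
    q(f) cancels from the equation. *)
Lemma denominator_descent (a b h : {mpoly k[n.+1]}) :
  a != 0 -> (a \mPo f) * h = b \mPo f -> exists g, h = g \mPo f.
Proof.
have [m] := ubnP (msize a); elim: m a b => // m IH a b am a0 E.
have fa0 : a \mPo f != 0.
  by apply: contraNneq a0 => e; apply/eqP/(comp_mpoly_inj0 k0 c0 fc).
have [fau|fau] := boolP (a \mPo f \is a GRing.unit).
  (* Units of k[x] are nonzero constants, so [h] is [b] divided by a scalar, taken at f. *)
  have /andP [/eqP faE faC] : (a \mPo f) \in @mpoly_unit n.+1 k := fau.
  exists (((a \mPo f)@_0)^-1 *: b); rewrite comp_mpolyZ -E -mul_mpolyC mulrA.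
  by rewrite {2}faE -mpolyCM mulVr // mul1r.
have [p [d [pp _ pE]]] :=
  exists_prime_divisor (@is_factorial_mpoly k n.+1) fa0 fau.
have pa : divides p (a \mPo f) by exists d.
have pb : divides p (b \mPo f) by rewrite -E; apply: divides_mulr.
have [q pq qP] := contraction_principal pp a0 pa.
have [[a' aE] [b' bE]] := (qP _ pa, qP _ pb).
have [q0 qu _] := pq.
have a'0 : a' != 0 by apply: contraNneq a0 => e; rewrite aE e mul0r.
have fq0 : q \mPo f != 0.
  by apply: contraNneq q0 => e; apply/eqP/(comp_mpoly_inj0 k0 c0 fc).
apply: (IH a' b') => //; last first.
  apply: (mulIf fq0); rewrite -rmorphM /= -bE -E aE rmorphM /=; ring.
(* [msize] is the degree plus one: [q] is not constant, so [a'] has smaller degree than [a]. *)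
have sq : (1 < msize q)%N.
  rewrite ltnNge; apply: contraNN qu => /msize1_polyC qE.
  by rewrite qE rmorph_unit // unitfE; apply: contraNneq q0 => e; rewrite qE e.
rewrite ltnS in am; apply: leq_trans am; rewrite aE msizeM //.
by rewrite -(subnKC sq) !addSn !addnS ltnS leq_addr.
Qed.

End Descent.

(** * The Bezoutian and birationality *)

Section Bezoutian.

Variables (k : fieldType) (n : nat) (f : polymor k n).

Definition diagonal_point : (n + n).-tuple {mpoly k[n]} :=
  [tuple match split i with inl j => 'X_j | inr j => 'X_j end | i < n + n].

Let diag : {rmorphism {mpoly k[n + n]} -> {mpoly k[n]}} :=
  comp_mpoly diagonal_point.

Lemma diag_x j : diag (bez_x k j) = 'X_j.
Proof.
rewrite /diag /= comp_mpolyXU -tnth_nth tnth_mktuple.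
by rewrite -/(unsplit (inl j)) unsplitK.
Qed.

Lemma diag_y j : diag (bez_y k j) = 'X_j.
Proof.
rewrite /diag /= comp_mpolyXU -tnth_nth tnth_mktuple.
by rewrite -/(unsplit (inr j)) unsplitK.
Qed.

Lemma diag_bez_point p m : diag (p \mPo bez_point k n m) = p.
Proof.
apply: (mpoly_rmorph_eq (g := diag \o comp_mpoly (bez_point k n m))
  (h := idfun)).
  by move=> c; rewrite /= !comp_mpolyC.
move=> i; change (diag ('X_i \mPo bez_point k n m) = 'X_i).
rewrite comp_mpolyXU -tnth_nth tnth_mktuple.
by case: ifP; rewrite ?diag_x ?diag_y.
Qed.

Lemma mderiv_bez_point l (j : 'I_n) m :
  (tnth (bez_point k n m) l)^`M(lshift n j) = ((l == j) && (m <= j)%N)%:R.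
Proof.
rewrite tnth_mktuple; case: ltnP => ml; rewrite mderivXU.
  rewrite eq_rlshift; case: eqP => // <-.
  by rewrite leqNgt ml.
by rewrite eq_lshift; case: eqP => [<-|//]; rewrite ml.
Qed.

(** Differentiate the defining equation of [Delta] in x_j and set y = x: the term with the
    derivative of [Delta] vanishes, and on the right only the first point still contains x_j. *)
Lemma diag_Delta i j : diag (Delta f i j) = (tnth f i)^`M(j).
Proof.
have := congr1 (fun p => diag p^`M(lshift n j)) (DeltaP f i j).
rewrite mderivM !mderivB !mderivXU eqxx eq_rlshift subr0 mulr1.
rewrite rmorphD rmorphM rmorphB diag_x diag_y subrr mulr0 add0r => ->.
rewrite /bez_num !mderiv_comp rmorphB !rmorph_sum /=.
rewrite [X in _ - X]big1 => [|l _]; last first.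
  by rewrite mderiv_bez_point ltnn andbF mulr0 comp_mpoly0.
rewrite subr0 (bigD1 j) //= big1 => [|l lj]; last first.
  by rewrite mderiv_bez_point (negbTE lj) mulr0 comp_mpoly0.
by rewrite mderiv_bez_point eqxx leqnn mulr1 addr0; apply: diag_bez_point.
Qed.

Lemma diag_Bez : diag (Bez f) = Jac f.
Proof.
rewrite /Bez -det_map_mx; congr (\det _); apply/matrixP => i j.
by rewrite !mxE diag_Delta.
Qed.

(** The numerators telescope from the point x ([bez_point] at 0) to the point y (at [n]). *)
Lemma Delta_sum i :
  \sum_j Delta f i j * (bez_x k j - bez_y k j) =
  (tnth f i \mPo bez_point k n 0) - (tnth f i \mPo bez_point k n n).
Proof.
rewrite (eq_bigr _ (fun j _ => DeltaP f i j)).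
pose F m := tnth f i \mPo bez_point k n m.
rewrite -[RHS]opprB -(telescope_sumr F (leq0n n)) big_mkord -sumrN.
by apply: eq_bigr => j _; rewrite opprB.
Qed.

(** Cramer's rule: the cofactors [a] are the entries of row [j] of the adjugate. *)
Lemma Bez_mul_in_ideal j : exists a : 'I_n -> {mpoly k[n + n]},
  Bez f * (bez_x k j - bez_y k j) =
  \sum_i a i *
    ((tnth f i \mPo bez_point k n 0) - (tnth f i \mPo bez_point k n n)).
Proof.
pose M := \matrix_(i < n, j < n) Delta f i j.
pose v := \col_(j < n) (bez_x k j - bez_y k j).
exists (fun i => (\adj M) j i).
have -> : Bez f * (bez_x k j - bez_y k j) = (\adj M *m (M *m v)) j 0.
  by rewrite mulmxA mul_adj_mx mul_scalar_mx !mxE.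
rewrite mxE; apply: eq_bigr => i _; congr (_ * _); rewrite -Delta_sum mxE.
by apply: eq_bigr => l _; rewrite !mxE.
Qed.

Definition curry_point (i : 'I_(n + n)) : {mpoly {mpoly k[n]}[n]} :=
  match split i with inl j => 'X_j | inr j => ('X_j)%:MP end.

(* k[x, y] as k[y][x]. *)
Let curry : {rmorphism {mpoly k[n + n]} -> {mpoly {mpoly k[n]}[n]}} :=
  mmap (@mpolyC n {mpoly k[n]} \o @mpolyC n k) curry_point.

Lemma curryX i : curry 'X_i = curry_point i.
Proof. by rewrite /curry /= mmapX mmap1U. Qed.

Lemma curry_x j : curry (bez_x k j) = 'X_j.
Proof. by rewrite curryX /curry_point -/(unsplit (inl j)) unsplitK. Qed.

Lemma curry_y j : curry (bez_y k j) = ('X_j)%:MP.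
Proof. by rewrite curryX /curry_point -/(unsplit (inr j)) unsplitK. Qed.

Lemma curryC c : curry c%:MP = c%:MP%:MP.
Proof. exact: mmapC. Qed.

Lemma curry_bez_point0 p :
  curry (p \mPo bez_point k n 0) = map_mpoly (@mpolyC n k) p.
Proof.
apply: (mpoly_rmorph_eq (g := curry \o comp_mpoly (bez_point k n 0))) => [c|i].
  by rewrite /= comp_mpolyC curryC map_mpolyC.
change (curry ('X_i \mPo bez_point k n 0) = map_mpoly (@mpolyC n k) 'X_i).
by rewrite comp_mpolyXU -tnth_nth tnth_mktuple curry_x map_mpolyX.
Qed.

Lemma curry_bez_pointn p : curry (p \mPo bez_point k n n) = p%:MP.
Proof.
apply: (mpoly_rmorph_eq (g := curry \o comp_mpoly (bez_point k n n))) => [c|i].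
  by rewrite /= comp_mpolyC curryC.
change (curry ('X_i \mPo bez_point k n n) = ('X_i)%:MP).
by rewrite comp_mpolyXU -tnth_nth tnth_mktuple ltn_ord curry_y.
Qed.

(** The same relation in k[y][x], where f(y) is a constant and f(x) has coefficients in k. *)
Lemma constant_Bez_ideal c j : Bez f = c%:MP ->
  exists a : 'I_n -> {mpoly {mpoly k[n]}[n]},
  c%:MP%:MP * ('X_j - ('X_j)%:MP) =
  \sum_i a i * (map_mpoly (@mpolyC n k) (tnth f i) - (tnth f i)%:MP).
Proof.
move=> fc; have [a aE] := Bez_mul_in_ideal j; exists (fun i => curry (a i)).
have := congr1 curry aE.
rewrite fc rmorphM rmorphB curryC curry_x curry_y => ->; rewrite rmorph_sum.
apply: eq_bigr => i _.
by rewrite rmorphM rmorphB curry_bez_point0 curry_bez_pointn.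
Qed.

End Bezoutian.

(** * Linear independence over a ring, and fractions from an epimorphism *)

Section LinearIndependence.

Variables (A B : idomainType) (phi : {rmorphism A -> B}).
Implicit Types (e : seq B) (b : B) (v : nat -> A).

(** Coefficients are functions on [nat], read below [size e], so that they need no reindexing when
    the family grows. *)
Definition lin_comb e v := \sum_(t < size e) phi (v t) * e`_t.

Definition lin_indep e :=
  forall v, lin_comb e v = 0 -> forall t, (t < size e)%N -> v t = 0.

Definition in_lin_span e b := exists v, b = lin_comb e v.

Lemma lin_comb_rcons e b v :
  lin_comb (rcons e b) v = lin_comb e v + phi (v (size e)) * b.
Proof.
rewrite /lin_comb size_rcons big_ord_recr /= nth_rcons ltnn eqxx; congr (_ + _).
by apply: eq_bigr => t _; rewrite nth_rcons ltn_ord.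
Qed.

Lemma in_lin_span_mul e a b : in_lin_span e b -> in_lin_span e (phi a * b).
Proof.
move=> [v ->]; exists (fun t => a * v t); rewrite /lin_comb mulr_sumr.
by apply: eq_bigr => t _; rewrite rmorphM mulrA.
Qed.

Lemma in_lin_span_rcons e b b' : in_lin_span e b -> in_lin_span (rcons e b') b.
Proof.
move=> [v ->]; exists (fun t => if (t < size e)%N then v t else 0).
rewrite lin_comb_rcons ltnn rmorph0 mul0r addr0; apply: eq_bigr => t _.
by rewrite ltn_ord.
Qed.

Lemma in_lin_span_last e b : in_lin_span (rcons e b) b.
Proof.
exists (fun t => if (t < size e)%N then 0 else 1).
rewrite lin_comb_rcons ltnn rmorph1 mul1r [lin_comb _ _]big1 ?add0r // => t _.
by rewrite ltn_ord rmorph0 mul0r.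
Qed.

(** In a nontrivial relation the coefficient of [b] is nonzero, since [e] is independent; it serves
    as the denominator [a]. *)
Lemma lin_indep_or_in_span e b : lin_indep e ->
  lin_indep (rcons e b) \/ exists2 a, a != 0 & in_lin_span e (phi a * b).
Proof.
move=> ie; have [|nie] := classic (lin_indep (rcons e b)); [by left|right].
apply: NNPP => H; apply: nie => v; rewrite lin_comb_rcons => E.
have ve : v (size e) = 0.
  apply/eqP/negPn/negP => v0; apply: H; exists (v (size e)) => //.
  exists (fun t => - v t); rewrite /lin_comb.
  under eq_bigr => t _ do rewrite rmorphN mulNr.
  by rewrite sumrN; apply/eqP; rewrite -addr_eq0 addrC; apply/eqP.
move=> t; rewrite size_rcons ltnS leq_eqVlt => /orP[/eqP->//|].
by apply: ie; rewrite ve rmorph0 mul0r addr0 in E.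
Qed.

(** The elements of [bs] either join the family or contribute a denominator. The prefix [e] keeps
    its positions, so coordinates along it remain identifiable. *)
Lemma lin_indep_extend e (bs : seq B) : lin_indep e ->
  exists e' a, [/\ lin_indep (e ++ e'), a != 0 &
    forall b, b \in bs -> in_lin_span (e ++ e') (phi a * b)].
Proof.
move=> ie; elim: bs => [|b bs [e' [a [ie' a0 sp]]]].
  by exists [::], 1; rewrite cats0 oner_neq0.
have [ib|[a' a'0 sb]] := lin_indep_or_in_span b ie'.
  exists (rcons e' b), a; rewrite -rcons_cat; split=> // b'.
  rewrite inE => /orP[/eqP->|/sp]; last exact: in_lin_span_rcons.
  exact/in_lin_span_mul/in_lin_span_last.
exists e', (a * a'); split=> //; first by rewrite mulf_neq0.
move=> b'; rewrite inE rmorphM => /orP[/eqP->|/sp].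
  by rewrite -mulrA; apply: in_lin_span_mul.
by rewrite mulrAC [_ * b' * _]mulrC; apply: in_lin_span_mul.
Qed.

Variable n : nat.
Let phiX : {rmorphism {mpoly A[n]} -> {mpoly B[n]}} := map_mpoly phi.

(** Independence is preserved by adjoining variables, as the relation can be read one monomial at a
    time. *)
Lemma lin_indep_mpoly e (V : nat -> {mpoly A[n]}) : lin_indep e ->
  \sum_(t < size e) phiX (V t) * (e`_t)%:MP = 0 ->
  forall t, (t < size e)%N -> V t = 0.
Proof.
move=> ie E t te; apply/mpolyP => m; rewrite mcoeff0.
apply: (ie (fun t => (V t)@_m)) => //.
have := congr1 (mcoeff m) E; rewrite mcoeff0 raddf_sum => F; rewrite -[RHS]F.
apply: eq_bigr => s _.
by rewrite /= [_ * _%:MP]mulrC mcoeffCM mulrC mcoeff_map_mpoly.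
Qed.

Lemma in_lin_span_mpoly e a (z : {mpoly B[n]}) :
  (forall m, m \in msupp z -> in_lin_span e (phi a * z@_m)) ->
  exists V : nat -> {mpoly A[n]},
    phiX a%:MP * z = \sum_(t < size e) phiX (V t) * (e`_t)%:MP.
Proof.
move=> sp; rewrite [in phiX _ * _](mpolyE z) mulr_sumr big_seq.
apply: (big_ind (fun x => exists V : nat -> {mpoly A[n]},
  x = \sum_(t < size e) phiX (V t) * (e`_t)%:MP))
  => [|x y [V ->] [V' ->]|m /sp [v vE]].
- exists (fun=> 0); rewrite big1 // => t _.
  by rewrite rmorph0 mul0r.
- exists (fun t => V t + V' t); rewrite -big_split /=; apply: eq_bigr => t _.
  by rewrite raddfD mulrDl.
- exists (fun t => v t *: 'X_[m]).
  rewrite /= map_mpolyC mul_mpolyC scalerA vE scaler_suml.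
  apply: eq_bigr => t _.
  by rewrite map_mpolyZ map_mpolyX [RHS]mulrC mul_mpolyC scalerA [in RHS]mulrC.
Qed.

(* Were 1 and x linearly independent over A, they would extend to a family
   whose span contains, up to a denominator [d], all the coefficients of the
   cofactors [a i].  Comparing the coordinates along x of both sides of the
   hypothesis on [a] and applying [graph] gives c d = 0. *)
Lemma fraction_of_epimorphism (graph : {rmorphism {mpoly A[n]} -> B}) (m : nat)
    (U : 'I_m -> {mpoly A[n]}) (a : 'I_m -> {mpoly B[n]}) (c : A) (x : B)
    (j : 'I_n) :
  (forall p, phi p = 0 -> p = 0) -> c != 0 ->
  (forall p, graph p%:MP = phi p) -> (forall i, graph (U i) = 0) ->
  (phi c)%:MP * ('X_j - x%:MP) = \sum_i a i * phiX (U i) ->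
  exists p q, q != 0 /\ phi q * x = phi p.
Proof.
move=> phi0 c0 graphC graphU aE; apply: NNPP => H.
have ie : lin_indep [:: 1; x].
  move=> v; rewrite /lin_comb /= !big_ord_recl big_ord0 /= mulr1 addr0 => E.
  have v1 : v 1%N = 0.
    apply/eqP/negPn/negP => v1; apply: H; exists (- v 0%N), (v 1%N); split=> //.
    by rewrite rmorphN; apply/eqP; rewrite -addr_eq0 addrC; apply/eqP.
  move: E; rewrite /bump /= v1 rmorph0 mul0r addr0 => /phi0 v0.
  by case=> [|[|]].
have [e' [d [ie' d0 sp]]] :=
  lin_indep_extend [seq (a i)@_m | i <- enum 'I_m, m <- msupp (a i)] ie.
set e := _ ++ e' in ie' sp.
have /fin_all_exists [V VE] i : exists V : nat -> {mpoly A[n]},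
    phiX d%:MP * a i = \sum_(t < size e) phiX (V t) * (e`_t)%:MP.
  apply: in_lin_span_mpoly => l li; apply: sp.
  by apply/allpairsPdep; exists i, l; split=> //; rewrite mem_enum.
(* The coordinates of d c (X_j - x): entries 0 and 1 of [e] are 1 and [x]. *)
pose L t : {mpoly A[n]} :=
  match t with
  | 0%N => (d * c)%:MP * 'X_j
  | 1%N => - (d * c)%:MP
  | _ => 0
  end.
have LE : \sum_(t < size e) phiX (L t) * (e`_t)%:MP =
    phiX d%:MP * ((phi c)%:MP * ('X_j - x%:MP)).
  rewrite /e /= !big_ord_recl big1 => [|t _]; last by rewrite rmorph0 mul0r.
  rewrite /L /bump /= rmorphN rmorphM /= map_mpolyX !map_mpolyC /=.
  by rewrite (rmorphM phi) mpolyCM mpolyC1; ring.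
have Z1 : \sum_i V i 1%N * U i - L 1%N = 0.
  apply: (lin_indep_mpoly (V := fun t => \sum_i V i t * U i - L t) ie') => //.
  under eq_bigr => t _ do rewrite rmorphB mulrBl rmorph_sum mulr_suml.
  rewrite sumrB LE aE exchange_big mulr_sumr -sumrB big1 // => i _.
  rewrite mulrA VE mulr_suml -sumrB big1 // => t _.
  by rewrite rmorphM mulrAC subrr.
have := congr1 graph Z1; rewrite rmorph0 rmorphB rmorph_sum big1 => [|i _].
  rewrite sub0r rmorphN opprK graphC => /phi0/eqP.
  by rewrite mulf_eq0 (negbTE c0) (negbTE d0).
by rewrite rmorphM graphU mulr0.
Qed.

End LinearIndependence.

(** Here A = k[u] maps to B = k[y] by u = f(y). The elements f_i(x) - u_i of A[x] vanish on the
    graph u = f(x) and become f_i(x) - f_i(y) in B[x]. *)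
Lemma variable_in_fraction_field (k : fieldType) (n : nat) (f : polymor k n)
    (c : k) (j : 'I_n) :
  (forall p, p \mPo f = 0 -> p = 0) -> c != 0 -> Bez f = c%:MP ->
  exists p q, q != 0 /\ (q \mPo f) * 'X_j = p \mPo f.
Proof.
move=> finj c0 fc; have [a aE] := constant_Bez_ideal j fc.
pose lift_x : {rmorphism {mpoly k[n]} -> {mpoly {mpoly k[n]}[n]}} :=
  map_mpoly (@mpolyC n k).
pose graph : {rmorphism {mpoly {mpoly k[n]}[n]} -> {mpoly k[n]}} :=
  mmap (comp_mpoly f) (fun i => 'X_i).
have graphC p : graph p%:MP = p \mPo f by apply: mmapC.
have graph_lift p : graph (lift_x p) = p.
  move: p; apply: (mpoly_rmorph_eq (g := graph \o lift_x) (h := idfun))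
    => [b|i].
    change (graph (lift_x b%:MP) = b%:MP).
    by rewrite /lift_x /= map_mpolyC graphC comp_mpolyC.
  change (graph (lift_x 'X_i) = 'X_i).
  by rewrite /lift_x /graph /= map_mpolyX mmapX mmap1U.
have lift_const p : map_mpoly (comp_mpoly f) (lift_x p) = lift_x p.
  move: p; apply: (mpoly_rmorph_eq (g := map_mpoly (comp_mpoly f) \o lift_x)).
    by move=> b /=; rewrite !map_mpolyC /= comp_mpolyC.
  by move=> i /=; rewrite !map_mpolyX.
have lift_xE p : lift_x p = map_mpoly (@mpolyC n k) p by [].
clearbody graph lift_x.
apply: (@fraction_of_epimorphism _ _ (comp_mpoly f) n graph n
  (fun i => lift_x (tnth f i) - ('X_i)%:MP) a c%:MP 'X_j j) => //.
- by rewrite mpolyC_eq0.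
- by move=> i; rewrite rmorphB graphC graph_lift comp_mpolyXU -tnth_nth subrr.
rewrite [X in X%:MP * _](_ : _ = c%:MP); last exact: comp_mpolyC.
apply: etrans aE _; apply: eq_bigr => i _; rewrite -lift_xE; congr (_ * _).
rewrite rmorphB /= lift_const map_mpolyC; congr (_ - _%:MP).
by rewrite /= comp_mpolyXU -tnth_nth.
Qed.

Theorem corollary1p6 (k : fieldType) (n : nat) (f : polymor k n) :
  [pchar k] =i pred0 ->
  (exists2 c : k, c != 0 & Jac f = c%:MP) ->
  (exists b : k, Bez f = b%:MP) ->
  pm_invertible f.
Proof.
move=> k0 [c c0 fc] [b fb].
(* Restriction to the diagonal turns the Bezoutian into the Jacobian, so its constant value is
   nonzero. *)
have bc : b = c.
  have := diag_Bez f; rewrite fb fc /= comp_mpolyC.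
  exact: (can_inj (@mpolyCK _ _)).
have finj := comp_mpoly_inj0 k0 c0 fc.
have /fin_all_exists [g gE] : forall j, exists g, 'X_j = g \mPo f.
  rewrite bc in fb.
  (* The descent singles out a variable, so it is stated for a positive dimension; in dimension 0 no
     index [j] exists. *)
  case: n f fc fb finj => [|m] f' fc fb finj j; first by case: j.
  have [p [q [q0 E]]] := variable_in_fraction_field j finj c0 fb.
  exact: (denominator_descent k0 c0 fc q0 E).
have gf : pm_comp [tuple g i | i < n] f = pm_id k n.
  by apply: eq_from_tnth => j; rewrite !tnth_mktuple gE.
exists [tuple g i | i < n]; split=> //.
(* The other composite follows by injectivity of substitution: f_i(g) - x_i becomes f_i(g(f)) - f_i
   = 0 at f. *)
apply: eq_from_tnth => i; rewrite !tnth_mktuple.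
apply/eqP; rewrite -subr_eq0; apply/eqP/finj; rewrite comp_mpolyB comp_mpolyA.
rewrite -[X in _ \mPo X]/(pm_comp _ f) gf comp_mpoly_id comp_mpolyXU -tnth_nth.
by rewrite subrr.
Qed.
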